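(* For $k\in[1,r]$, $$H_k(A_1,\dots,A_{2r})=\sum_{I}\prod_{i\in I}\gamma_i,$$ where the sum runs over all $k$-element subsets $I\subseteq[1,2r+1]$ of pairwise nonadjacent vertices of the graph $G_r$.
   Context: Fix $r\ge1$. Let $\mathbb{T}=\mathbb{R}^2/(2\mathbb{Z}\times(r+1)\mathbb{Z})$ and let $G$ be the bipartite graph embedded in $\mathbb{T}$ with vertices $(x,y)$, $x\in\{0,1\}$ (mod 2), $y\in\{0,\dots,r\}$, $(x,y)$ black iff $x+y$ odd; edges: for each $y\in\{0,\dots,r\}$ the horizontal segments $[0,1]\times\{y\}$ and $[1,2]\times\{y\}$, and for each $y\in\{0,\dots,r-1\}$, $x\in\{0,1\}$ the vertical segment $\{x\}\times[y,y+1]$. Faces: the annulus $(\mathbb{R}/2\mathbb{Z})\times(r,r+1)$ is labeled $0$; for $a\in[1,r]$ odd, $(0,1)\times(a-1,a)$ is labeled $a$ and $(1,2)\times(a-1,a)$ is labeled $r+a$; for $a$ even, $(1,2)\times(a-1,a)$ is labeled $a$ and $(0,1)\times(a-1,a)$ is labeled $r+a$. Face $0$ has weight $1$, face $i\in[1,2r]$ weight $A_i\in\mathbb{C}^*$. For a perfect matching $M$, $w(M)=\prod_{e\in M}(A_iA_j)^{-1}$ with $i,j$ the faces on either side of $e$. $M_0$ is the perfect matching consisting, for each $y$, of the horizontal edge at height $y$ whose left endpoint ($(0,y)$ for $[0,1]\times\{y\}$, $(1,y)$ for $[1,2]\times\{y\}$) is black. For $M$ a perfect matching, orient edges of $M$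 black$\to$white and of $M_0$ white$\to$black, discard common edges, and let $[M]_{M_0}\in H_1(\mathbb{T},\mathbb{Z})$ be the class of the resulting oriented loops. Let $\eta\in H_1(\mathbb{T},\mathbb{Z})$ be the class of a horizontal loop traversed once in the direction of decreasing $x$, and $H_k:=\sum_{M:[M]_{M_0}=k\eta}w(M)/w(M_0)$. Write $q_a=A_a$, $p_a=A_{r+a}$ for $a\in[1,r]$ and $q_0=q_{r+1}=p_0=p_{r+1}=1$. Define $\gamma_{2a-1}=\dfrac{q_{a-1}p_a}{q_ap_{a-1}}$ for $a\in[1,r+1]$ and $\gamma_{2a}=\dfrac{q_{a-1}p_{a+1}}{q_ap_a}$ for $a\in[1,r]$. $G_r$ is the graph with vertex set $[1,2r+1]$ and edges $\{i,i+1\}$ for $i\in[1,2r]$ and $\{2a,2a+2\}$ for $a\in[1,r-1]$. *)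

(* Defs.v *)
From mathcomp Require Import all_boot all_order all_algebra.
From mathcomp Require Import boolp reals.
From mathcomp Require Export complex.

Set Implicit Arguments.
Unset Strict Implicit.
Unset Printing Implicit Defensive.

Import Order.TTheory GRing.Theory Num.Theory.
Local Open Scope ring_scope.
Local Open Scope complex_scope.

(* The torus R^2/(2Z x (r+1)Z) carries the unit-square cell structure with
   2(r+1) vertices, 4(r+1) edges and 2(r+1) squares. Vertices and squares are
   both indexed by (x, y), x mod 2, y mod r+1: the square (x, y) is
   ]x, x+1[ x ]y, y+1[. The graph G uses all the edges of this cell structure
   except the two vertical ones with y = r, which subdivide the annulus
   labeled 0; these two are only needed to compute the homology of the torus,
   the annulus not being a cell. *)

Notation vertex r := ('I_2 * 'I_r.+1)%type.
Notation square r := ('I_2 * 'I_r.+1)%type.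

(* inl (x, y) is the horizontal segment [x, x+1] x {y} and
   inr (x, y) is the vertical segment {x} x [y, y+1]. *)
Notation edge r := (vertex r + vertex r)%type.

Section Graph.
Variable r : nat.
Implicit Types (e : edge r) (v : vertex r) (f : square r) (M : {set edge r}).

Definition edge_src e : vertex r :=
  match e with inl v => v | inr v => v end.

Definition edge_tgt e : vertex r :=
  match e with
  | inl (x, y) => (ordS x, y)
  | inr (x, y) => (x, ordS y)
  end.

Definition black v : bool := odd (v.1 + v.2).

Definition graph_edges : {set edge r} :=
  [set e : edge r | match e with inl _ => true | inr (_, y) => (y < r)%N end].

Definition incident v e : bool := (v == edge_src e) || (v == edge_tgt e).

Definition perfect_matching M : bool :=
  (M \subset graph_edges) && [forall v, #|[set e in M | incident v e]| == 1%N].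

Definition M0 : {set edge r} :=
  [set e : edge r | match e with inl v => black v | inr _ => false end].

Definition face_label f : nat :=
  let: (x, y) := f in
  if y == r :> nat then 0%N
  else let a := y.+1 in
    if odd a == (x == 0%N :> nat) then a else (r + a)%N.

Definition side_faces e : square r * square r :=
  match e with
  | inl (x, y) => ((x, y), (x, ord_pred y))
  | inr (x, y) => ((x, y), (ord_pred x, y))
  end.

(* Cellular chains; edges are oriented in the direction of increasing
   coordinates and squares counterclockwise. *)
Notation chain1 := {ffun edge r -> int}.

Definition edge_chain e : chain1 := [ffun e' => (e' == e)%:R].

Definition square_boundary f : chain1 :=
  let: (x, y) := f in
  edge_chain (inl (x, y)) + edge_chain (inr (ordS x, y))
  - edge_chain (inl (x, ordS y)) - edge_chain (inr (x, y)).

(* Equality in H_1 of the classes of two 1-cycles. *)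
Definition homologous (c d : chain1) : Prop :=
  exists F : square r -> int, c - d = \sum_f square_boundary f *~ F f.

Definition black_to_white e : chain1 :=
  if black (edge_src e) then edge_chain e else - edge_chain e.

(* The sum of the oriented loops obtained by superimposing M and M0. *)
Definition loops M : chain1 :=
  \sum_(e in M :\: M0) black_to_white e
  - \sum_(e in M0 :\: M) black_to_white e.

(* The horizontal loop at height 0, in the direction of decreasing x. *)
Definition eta : chain1 := - \sum_(x : 'I_2) edge_chain (inl (x, ord0)).

End Graph.

Section Weights.
Variables (R : realType) (r : nat) (A : nat -> R[i]).

Definition face_weight (l : nat) : R[i] := if l == 0%N then 1 else A l.

Definition edge_weight (e : edge r) : R[i] :=
  (face_weight (face_label (side_faces e).1)
   * face_weight (face_label (side_faces e).2))^-1.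

Definition matching_weight (M : {set edge r}) : R[i] :=
  \prod_(e in M) edge_weight e.

Definition Hk (k : nat) : R[i] :=
  \sum_(M : {set edge r} |
        perfect_matching M && `[< homologous (loops M) (eta r *+ k) >])
    matching_weight M / matching_weight (M0 r).

Definition q_ (a : nat) : R[i] := if (1 <= a <= r)%N then A a else 1.
Definition p_ (a : nat) : R[i] := if (1 <= a <= r)%N then A (r + a)%N else 1.

(* i = 2a-1 or i = 2a, with a = uphalf i in both cases. *)
Definition gamma (i : nat) : R[i] :=
  let a := uphalf i in
  if odd i then (q_ a.-1 * p_ a) / (q_ a * p_ a.-1)
  else (q_ a.-1 * p_ a.+1) / (q_ a * p_ a).

End Weights.

Definition Gr_edge (r i j : nat) : bool :=
  ((1 <= i <= 2 * r)%N && (j == i.+1))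
  || [exists a : 'I_r,
        [&& (1 <= a)%N, i == (2 * a)%N & j == (2 * a + 2)%N]].

Definition Gr_adjacent (r i j : nat) : bool := Gr_edge r i j || Gr_edge r j i.

(* The ordinal i stands for the vertex i+1 of G_r, whose vertex set is
   [1, 2r+1]. *)
Definition Gr_independent (r : nat) (I : {set 'I_(2 * r).+1}) : bool :=
  [forall i in I, forall j in I, ~~ Gr_adjacent r i.+1 j.+1].

(* Main.v *)
(* In a perfect matching the vertical edges come in pairs {(0,y)-(0,y+1), (1,y)-(1,y+1)}, so a
   perfect matching is the choice, in each row, of the edge of M0, of the other horizontal
   edge, or of half of such a pair. Sending "other edge in row y" to the vertex 2y+1 of G_r and
   "pair between rows y and y+1" to 2y+2 identifies perfect matchings with independent sets:
   two vertices are adjacent exactly when they use a common row. Each chosen vertex i adds one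
   loop homologous to eta and multiplies the weight by gamma_i, and the flux through a vertical
   loop shows that the multiples of eta are not homologous to one another. *)
From HB Require Import structures.
Require Import Defs.
From mathcomp Require Import all_boot all_order all_algebra.
From mathcomp Require Import reals boolp ring zify.

Set Implicit Arguments.
Unset Strict Implicit.
Unset Printing Implicit Defensive.

Import Order.TTheory GRing.Theory Num.Theory.
Local Open Scope ring_scope.
Local Open Scope complex_scope.

(** * Columns mod 2 as booleans, and tools for big operators *)

(** With columns named by booleans, the colour of a vertex is an exclusive or with the parity of its
    row, so questions of colour become case analyses. *)
Definition side (b : bool) : 'I_2 := inord b.

Lemma val_side b : side b = b :> nat.
Proof. by rewrite inordK //; case: b. Qed.

Lemma sideP (x : 'I_2) : x = side (odd x).
Proof. by apply: val_inj; rewrite /= val_side; case: x => [[|[]]]. Qed.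

Lemma side_eq a b : (side a == side b) = (a == b).
Proof. by rewrite -val_eqE /= !val_side; case: a; case: b. Qed.

Lemma ordS_side b : ordS (side b) = side (~~ b).
Proof. by apply: val_inj; rewrite /= !val_side; case: b. Qed.

Lemma ord_pred_side b : ord_pred (side b) = side (~~ b).
Proof. by apply: val_inj; rewrite /= !val_side; case: b. Qed.

(** The free [b] lets either column come first, to match the colours in a given row. *)
Lemma big_side (T : Type) (idx : T) (op : Monoid.com_law idx) b (F : 'I_2 -> T) :
  \big[op/idx]_(x : 'I_2) F x = op (F (side b)) (F (side (~~ b))).
Proof.
rewrite (bigD1 (side b)) //= (big_pred1 (side (~~ b))) // => x /=.
by rewrite (sideP x) !side_eq; case: (odd x); case: b.
Qed.

(** After exchanging the two operations, the inner one repeats [F e] once for each [U i] containing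
    [e]: by hypothesis once on [S] and never outside it. *)
Lemma big_cover (I T : finType) (V : Type) (idx : V) (op : Monoid.com_law idx)
    (P : {set I}) (U : I -> {set T}) (S : {set T}) (F : T -> V) :
  (forall e, #|[set i in P | e \in U i]| = (e \in S)) ->
  \big[op/idx]_(e in S) F e = \big[op/idx]_(i in P) \big[op/idx]_(e in U i) F e.
Proof.
move=> cardU; rewrite (exchange_big_dep xpredT) //= big_mkcond; apply: eq_bigr => e _.
rewrite big_const -cardsE cardU.
by case: (e \in S); rewrite /= ?Monoid.mulm1.
Qed.

(** * Degree equations of a perfect matching *)

Section Torus.
Variable r : nat.
Hypothesis r_gt0 : (0 < r)%N.
Implicit Types (y : 'I_r.+1) (M : {set edge r}).

Lemma black_side b y : black (side b, y) = b (+) odd y.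
Proof. by rewrite /black /= val_side oddD; case: b. Qed.

Lemma ord_pred_gt0 y : (0 < y)%N -> ord_pred y = y.-1 :> nat.
Proof.
move=> y0 /=; have -> : ((y + r.+1).-1 = y.-1 + r.+1)%N by lia.
by rewrite modnDr modn_small // (leq_ltn_trans (leq_pred _)).
Qed.

Lemma ord_pred0 y : y = 0%N :> nat -> ord_pred y = r :> nat.
Proof. by move=> y0 /=; rewrite y0 modn_small. Qed.

(** As [r > 0] there are at least two rows; hence the two vertical edges at a vertex are distinct in
    the degree count below. *)
Lemma ord_pred_neq y : (y == ord_pred y) = false.
Proof.
apply/negbTE/eqP => /(congr1 val); case: (posnP y) => y0.
  by rewrite [RHS]ord_pred0 //=; lia.
by rewrite [RHS]ord_pred_gt0 //=; lia.
Qed.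

(** Rows have length 2, so both horizontal edges of a row meet both of its vertices, and their
    contribution does not depend on [b]. The first one listed has a white left end, the second one
    lies in [M0]. *)
Lemma card_incident M b y :
  #|[set e in M | incident (side b, y) e]| =
  ((inl (side (odd y), y) \in M) + (inl (side (~~ odd y), y) \in M)
   + ((inr (side b, y) \in M) + (inr (side b, ord_pred y) \in M)))%N.
Proof.
have -> : [set e in M | incident (side b, y) e] =
    [set e in [set inl (side (odd y), y); inl (side (~~ odd y), y);
      inr (side b, y); inr (side b, ord_pred y)] | e \in M].
  apply/setP => -[[x z]|[x z]]; rewrite !inE /incident /= andbC; congr (_ && _).
    rewrite !(inj_eq (@inl_inj _ _)) !xpair_eqE !orbF (sideP x) ordS_side !side_eq.
    rewrite (eq_sym y z); case: (z == y); rewrite ?andbF ?andbT //.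
    by case: b; case: (odd x); case: (odd y).
  rewrite !(inj_eq (@inr_inj _ _)) !xpair_eqE /= (sideP x) !side_eq.
  rewrite (eq_sym b) (eq_sym y z) -(inj_eq (@ord_pred_inj _) y) ordSK.
  by rewrite (eq_sym (ord_pred y)); case: eqP.
rewrite -sum1_card (eq_bigl (fun e => (e \in [set inl (side (odd y), y); inl (side (~~ odd y), y);
      inr (side b, y); inr (side b, ord_pred y)]) && (e \in M))); last by move=> e; rewrite !inE.
rewrite big_mkcondr /= -!setUA !big_setU1 ?big_set1 /=; first by rewrite !addnA; do 4!case: (_ \in M).
- by rewrite !inE !(inj_eq (@inr_inj _ _)) xpair_eqE ord_pred_neq andbF.
- by rewrite !inE.
- by rewrite !inE !(inj_eq (@inl_inj _ _)) xpair_eqE side_eq; case: (odd y).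
Qed.

Lemma perfect_matchingP M :
  reflect (M \subset graph_edges r /\ forall b y,
    ((inl (side (odd y), y) \in M) + (inl (side (~~ odd y), y) \in M)
     + ((inr (side b, y) \in M) + (inr (side b, ord_pred y) \in M)) = 1)%N)
  (perfect_matching M).
Proof.
apply: (iffP andP) => -[MG deg]; split=> //.
  by move=> b y; have /eqP := forallP deg (side b, y); rewrite card_incident.
by apply/forallP => -[x y]; rewrite (sideP x) card_incident deg.
Qed.

(** The two vertices of a row have the same horizontal degree, hence the same vertical degree. If
    the edges below the row agree, so do those above it, and induction climbs from row 0. *)
Lemma vertical_pair M b y :
  perfect_matching M -> (inr (side b, y) \in M) = (inr (side (~~ b), y) \in M).
Proof.
case/perfect_matchingP => /subsetP MG deg.
suff H n : forall z : 'I_r.+1, z = n :> nat ->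
    (inr (side true, z) \in M) = (inr (side false, z) \in M).
  by case: b; rewrite (H y y).
have no_r c (z : 'I_r.+1) : z = r :> nat -> (inr (side c, z) \in M) = false.
  by move=> zr; apply/negP => /MG; rewrite inE zr ltnn.
elim: n => [|n IH] z zn.
  (* Below row 0 the cyclic predecessor is row [r], whose upward edges are not in the graph. *)
  have:= etrans (deg true z) (esym (deg false z)); rewrite !(no_r _ (ord_pred z)) ?ord_pred0 //.
  by move/addnI; do 2!case: (_ \in M).
have:= etrans (deg true z) (esym (deg false z)); rewrite (IH (ord_pred z)) ?ord_pred_gt0 ?zn //.
by move/addnI/addIn; do 2!case: (_ \in M).
Qed.

(* The ordinal [j = 2y] replaces the edge of [M0] at height [y] by the other
   horizontal edge, and [j = 2y+1] replaces those at heights [y] and [y+1] by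
   the two vertical edges between them. *)
Notation tile := 'I_(2 * r).+1.
Implicit Types (v : vertex r) (j : tile) (I : {set tile}).

(** * Sets of tiles, and when they produce a perfect matching *)

Definition touches j y : bool :=
  [|| j == y.*2 :> nat, j == y.*2.+1 :> nat | j.+1 == y.*2].

Definition removed j : {set edge r} :=
  [set e : edge r | match e with inl v => black v && touches j v.2 | inr _ => false end].

Definition added j : {set edge r} :=
  [set e : edge r | match e with
           | inl v => ~~ black v && (j == v.2.*2 :> nat)
           | inr v => j == v.2.*2.+1 :> nat
           end].

Definition tiling I : {set edge r} :=
  (M0 r :\: \bigcup_(j in I) removed j) :|: \bigcup_(j in I) added j.

(** One edge of [added j] is enough evidence for [j], since a perfect matching contains both
    vertical edges of a pair or neither. *)
Definition tiles M : {set tile} := [set j | [exists e in M, e \in added j]].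

(** Testing membership on natural numbers gives a meaning to the index [2r+1], which is no tile but
    comes up in row [r] and, through [ord_pred], in row 0. *)
Definition occ I (n : nat) : bool := [exists j in I, j == n :> nat].

Lemma occP I n : reflect (exists2 j, j \in I & j = n :> nat) (occ I n).
Proof.
apply: (iffP exists_inP) => -[j jI jn]; exists j => //; first exact/eqP.
exact/eqP.
Qed.

Lemma occ_val I j : occ I j = (j \in I).
Proof.
apply/occP/idP => [[i iI /val_inj <-//]|jI]; by exists j.
Qed.

Lemma tiling_vertical I v : (inr v \in tiling I) = occ I v.2.*2.+1.
Proof.
rewrite !inE andbF orFb; apply/bigcupP/occP => -[j jI jv]; exists j => //.
  by move: jv; rewrite inE => /eqP.
by rewrite inE jv.
Qed.

Lemma tiling_white I v : ~~ black v -> (inl v \in tiling I) = occ I v.2.*2.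
Proof.
move=> bv; rewrite !inE (negbTE bv) andbF orFb.
apply/bigcupP/occP => -[j jI jv]; exists j => //.
  by move: jv; rewrite inE => /andP[_ /eqP].
by rewrite inE bv jv /=.
Qed.

(** This is the number of tiles of [I] that touch row [y], and also the degree contributed at each
    vertex of the row by edges outside [M0]. *)
Definition load I y : nat :=
  (occ I y.*2 + (occ I y.*2.+1 + occ I (ord_pred y).*2.+1))%N.

Lemma occ_big I n : (2 * r < n)%N -> occ I n = false.
Proof.
by move=> rn; apply/negbTE/occP => -[j _ jn]; have := ltn_ord j; lia.
Qed.

(** For [y = 0] the cyclic predecessor yields [2r+1], beyond the last tile, so wrapping around
    creates no contact. *)
Lemma touchesE j y :
  touches j y = [|| j == y.*2 :> nat, j == y.*2.+1 :> nat | j == (ord_pred y).*2.+1 :> nat].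
Proof.
rewrite /touches; congr [|| _, _ | _]; case: (posnP y) => y0.
  by rewrite ord_pred0 // y0; have := ltn_ord j; lia.
by rewrite ord_pred_gt0 //; lia.
Qed.

Lemma load0 I y : (load I y == 0%N) = ~~ [exists j in I, touches j y].
Proof.
rewrite /load !addn_eq0 !eqb0 -!negb_or; congr (~~ _).
apply/or3P/exists_inP => [touched|[j jI]].
  by case: touched => /occP[j jI jy]; exists j => //; rewrite touchesE jy eqxx ?orbT.
rewrite touchesE => /or3P[] /eqP jy; [constructor 1|constructor 2|constructor 3].
all: by apply/occP; exists j.
Qed.

Lemma tiling_black I v : black v -> (inl v \in tiling I) = (load I v.2 == 0%N).
Proof.
move=> bv; rewrite load0 !inE bv andbT.
have /negbTE-> : inl v \notin \bigcup_(j in I) added j.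
  by apply/bigcupP => -[j _]; rewrite inE bv.
rewrite orbF; congr (~~ _).
by apply/bigcupP/exists_inP => -[j jI]; rewrite ?inE ?bv => jv; exists j => //; rewrite inE bv.
Qed.

(** The [M0] edge of a row survives exactly when the load is 0, so every vertex of the row has
    degree [(load == 0) + load], which is 1 exactly when the load is at most 1. *)
Lemma perfect_tiling I : perfect_matching (tiling I) = [forall y, (load I y <= 1)%N].
Proof.
have E b y : ((inl (side (odd y), y) \in tiling I)
     + (inl (side (~~ odd y), y) \in tiling I)
     + ((inr (side b, y) \in tiling I) + (inr (side b, ord_pred y) \in tiling I))
     = (load I y == 0) + load I y)%N.
  rewrite tiling_white ?black_side ?addbb // tiling_black ?black_side; last by case: odd.
  by rewrite !tiling_vertical /= /load; do 3!case: (occ _ _).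
apply/perfect_matchingP/forallP => [[_ deg] y|Iy].
  by have := deg true y; rewrite E; lia.
split=> [|b y]; last by rewrite E; have := Iy y; case: (load I y) => [|[]].
apply/subsetP => -[v _|[x y]]; first by rewrite inE.
rewrite tiling_vertical inE /=.
(* A tile [2y+1] is at most [2r], which forces [y < r]. *)
by case/occP => j _ jy; have := ltn_ord j; lia.
Qed.

(** In the labels of [G_r], the tiles touching row [y] are those of [2y], [2y+1], [2y+2] that lie in
    range. They form a clique, and every edge of [G_r] lies in one of these cliques. *)
Lemma independentE I : Gr_independent I = [forall y, (load I y <= 1)%N].
Proof.
apply/forall_inP/forallP => [ind y|ld i iI].
  have ind' i j : i \in I -> j \in I -> ~~ Gr_adjacent r i.+1 j.+1.
    by move=> iI jI; have /forall_inP := ind _ iI; apply.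
  (* This covers all pairs of tiles touching a common row; those at distance 2 are [2y-1] and
     [2y+1], whence the parity condition. *)
  have nadj m n : (m < n <= m.+2)%N -> (n == m.+2 -> odd m) -> ~~ (occ I m && occ I n).
    move=> mn odd_m; apply/negP => /andP[/occP[i iI im] /occP[j jI jn]].
    have /negP := ind' i j iI jI; apply; apply/orP; left; apply/orP.
    have jr := ltn_ord j.
    case: (eqVneq n m.+1) => [nm|nm]; [left; lia|right].
    (* The label [m+1] is [2a] with [m] odd, so [a = m./2 + 1]; the bound follows from
       [m+2 <= 2r]. *)
    have lt_r : (m./2.+1 < r)%N by lia.
    apply/existsP; exists (Ordinal lt_r) => /=; lia.
  rewrite /load.
  case: (posnP y) => y0.
    rewrite ord_pred0 // [occ I r.*2.+1]occ_big; last by lia.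
    by have := nadj y.*2 y.*2.+1; lia.
  rewrite ord_pred_gt0 //.
  have := nadj y.*2 y.*2.+1; have := nadj y.-1.*2.+1 y.*2.+1; have := nadj y.-1.*2.+1 y.*2.
  by lia.
apply/forall_inP => j jI; apply/negP.
have sym i1 j1 : i1 \in I -> j1 \in I -> ~~ Gr_edge r i1.+1 j1.+1.
  move=> iI1 jI1; apply/negP.
  have oi : occ I i1 by rewrite occ_val.
  have oj : occ I j1 by rewrite occ_val.
  have ri := ltn_ord i1; have rj := ltn_ord j1.
  case/orP => [/andP[_ /eqP[ji]]|/existsP[a /and3P[a0 /eqP ia /eqP ja]]].
    (* Consecutive tiles share row [uphalf i1], whatever the parity of [i1]. *)
    have lt_r : (uphalf i1 < r.+1)%N by lia.
    have := ld (Ordinal lt_r); rewrite /load; rewrite ji in oj.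
    case i_odd: (odd i1).
      rewrite ord_pred_gt0 /=; last by lia.
      have <- : i1 = (uphalf i1).-1.*2.+1 :> nat by lia.
      have <- : i1.+1 = (uphalf i1).*2 by lia.
      by rewrite oi oj; lia.
    have /= -> : (uphalf i1).*2 = i1 by lia.
    by rewrite oi oj; lia.
  (* The tiles [2a-1] and [2a+1] share row [a]. *)
  have := ld (widen_ord (leqnSn r) a); rewrite /load ord_pred_gt0 //=.
  have <- : i1 = a.-1.*2.+1 :> nat by lia.
  have <- : j1 = a.*2.+1 :> nat by lia.
  by rewrite oi oj; lia.
by case/orP; apply/negP; apply: sym.
Qed.

(** * The inverse correspondence, from matchings to sets of tiles *)

Lemma occ_tiles_white M v : ~~ black v -> occ (tiles M) v.2.*2 = (inl v \in M).
Proof.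
move=> bv; have lt_r : (v.2.*2 < (2 * r).+1)%N by have := ltn_ord v.2; lia.
rewrite -[X in occ _ X]/(nat_of_ord (Ordinal lt_r)) occ_val inE.
apply/exists_inP/idP => [[[w|w] wM]|vM]; last first.
- by exists (inl v); rewrite // inE bv /=.
- by rewrite inE /=; lia.
rewrite inE => /andP[bw /eqP/double_inj/ord_inj vw].
suff <- : w = v by [].
case: v w bv bw vw wM {lt_r} => [x y] [x' y'] /= bv bw yy _.
move: bv bw; rewrite -yy (sideP x) (sideP x') !black_side => bv bw.
by congr (side _, _); move: bv bw; do 3!case: odd.
Qed.

Lemma occ_tiles_vertical M v :
  perfect_matching M -> occ (tiles M) v.2.*2.+1 = (inr v \in M).
Proof.
move=> pM; have /perfect_matchingP[/subsetP MG _] := pM.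
apply/occP/idP => [[j]|vM].
  rewrite inE => /exists_inP[[w|w] wM]; rewrite inE.
    by move=> /andP[_ /eqP->]; lia.
  move=> /eqP-> [] /double_inj/ord_inj vw; move: wM.
  case: v w vw => [x y] [x' y'] /= ->.
  rewrite (sideP x) (sideP x'); have [->//|ne] := eqVneq (odd x) (odd x').
  have -> : odd x = ~~ odd x' by move: ne; do 2!case: odd.
  by rewrite -vertical_pair.
have lt_r : (v.2.*2.+1 < (2 * r).+1)%N.
  by have := MG _ vM; rewrite inE; case: v {vM} => x y /=; lia.
by exists (Ordinal lt_r); rewrite // inE; apply/exists_inP; exists (inr v); rewrite ?inE.
Qed.

(** Edges outside [M0] are recovered directly from the tiles; the [M0] edge of each row is then
    forced by the degree equation. *)
Lemma tilesK M : perfect_matching M -> tiling (tiles M) = M.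
Proof.
move=> pM; apply/setP => -[v|v]; last by rewrite tiling_vertical occ_tiles_vertical.
case bv: (black v); last by rewrite tiling_white ?bv // occ_tiles_white ?bv.
rewrite tiling_black //; case: v bv => x y; rewrite (sideP x) black_side => bv.
have xE : odd x = ~~ odd y by move: bv; do 2!case: odd.
have wy : ~~ black (side (odd y), y) by rewrite black_side addbb.
rewrite /load (occ_tiles_white M wy) (occ_tiles_vertical (side true, y) pM).
rewrite (occ_tiles_vertical (side true, ord_pred y) pM) xE.
have /perfect_matchingP[_ /(_ true y)] := pM.
by do 4!case: (_ \in M).
Qed.

(** Tiles add edges outside [M0] and remove edges inside it, so no tile erases the trace of another,
    and each added edge determines its tile. *)
Lemma tilingK I : tiles (tiling I) = I.
Proof.
apply/setP => j; rewrite inE -occ_val; apply/exists_inP/idP => [[[v|v]]|Ij].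
- move=> vI; rewrite inE => /andP[bv /eqP->]; by rewrite -tiling_white.
- by rewrite tiling_vertical => vI; rewrite inE => /eqP->.
have lt_r : (j./2 < r.+1)%N by have := ltn_ord j; lia.
pose y := Ordinal lt_r; have [j_odd|j_even] := boolP (odd j).
  have jE : j = (true, y).2.*2.+1 :> nat by rewrite /=; lia.
  exists (inr (side true, y)); last by rewrite inE jE.
  by rewrite tiling_vertical -jE.
have jE : j = y.*2 :> nat by rewrite /=; lia.
have wy : ~~ black (side (odd y), y) by rewrite black_side addbb.
exists (inl (side (odd y), y)); last by rewrite inE wy jE /=.
by rewrite tiling_white //= -jE.
Qed.

(** * Decomposition of the difference with [M0] into tiles *)

Lemma sum_occ I n : (\sum_(j in I) (j == n :> nat) = occ I n)%N.
Proof.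
case: (occP I n) => [[j jI jn]|nocc].
  rewrite (bigD1 j) //= jn eqxx big1 // => i /andP[_ ij].
  by rewrite -jn val_eqE (negbTE ij).
by rewrite big1 // => i iI; case: eqP => // jn; case: nocc; exists i.
Qed.

Lemma card_touches I y : #|[set j in I | touches j y]| = load I y.
Proof.
rewrite -sum1_card (eq_bigl (fun j => (j \in I) && touches j y)); last by move=> j; rewrite !inE.
rewrite big_mkcondr /load -!sum_occ -!big_split; apply: eq_bigr => j _.
rewrite touchesE; case: (posnP y) => y0.
  by rewrite ord_pred0 //; have := ltn_ord j; do 3![case: eqP => /=]; lia.
by rewrite ord_pred_gt0 //; do 3![case: eqP => /=]; lia.
Qed.

Lemma card_eq_val I n : #|[set j in I | j == n :> nat]| = occ I n.
Proof.
rewrite -sum1_card (eq_bigl (fun j => (j \in I) && (j == n :> nat))); last by move=> j; rewrite !inE.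
by rewrite big_mkcondr -sum_occ; apply: eq_bigr => j _; case: eqP.
Qed.

Lemma inl_M0 v : (inl v \in M0 r) = black v.
Proof. by rewrite inE. Qed.

Lemma inr_M0 v : (inr v \in M0 r) = false.
Proof. by rewrite inE. Qed.

Lemma big_added (V : Type) (idx : V) (op : Monoid.com_law idx) I (F : edge r -> V) :
  \big[op/idx]_(e in tiling I :\: M0 r) F e =
  \big[op/idx]_(j in I) \big[op/idx]_(e in added j) F e.
Proof.
apply: big_cover => -[v|v]; rewrite in_setD ?inl_M0 ?inr_M0 /=; last first.
  by rewrite tiling_vertical -card_eq_val; congr #|pred_of_set _|; apply/setP => j; rewrite !inE.
case bv: (black v) => /=.
  by apply/eqP; rewrite cards_eq0; apply/eqP/setP => j; rewrite !inE bv andbF.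
rewrite tiling_white ?bv // -card_eq_val; congr #|pred_of_set _|.
by apply/setP => j; rewrite !inE bv.
Qed.

(** Independence bounds each load by 1, so a removed edge is charged to exactly one tile. *)
Lemma big_removed (V : Type) (idx : V) (op : Monoid.com_law idx) I (F : edge r -> V) :
  Gr_independent I ->
  \big[op/idx]_(e in M0 r :\: tiling I) F e =
  \big[op/idx]_(j in I) \big[op/idx]_(e in removed j) F e.
Proof.
rewrite independentE => /forallP indI.
apply: big_cover => -[v|v]; rewrite in_setD ?inl_M0 ?inr_M0 ?andbF /=; last first.
  by apply/eqP; rewrite cards_eq0; apply/eqP/setP => j; rewrite !inE andbF.
case bv: (black v) => /=; last first.
  by apply/eqP; rewrite andbF cards_eq0; apply/eqP/setP => j; rewrite !inE bv andbF.
have -> : [set j in I | inl v \in removed j] = [set j in I | touches j v.2].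
  by apply/setP => j; rewrite !inE bv.
by rewrite card_touches tiling_black //; have := indI v.2; case: (load _ _) => [|[]].
Qed.

Lemma big_added_even (V : Type) (idx : V) (op : Monoid.com_law idx) j y (F : edge r -> V) :
  j = y.*2 :> nat -> \big[op/idx]_(e in added j) F e = F (inl (side (odd y), y)).
Proof.
move=> jy; rewrite -[RHS](big_set1 op).
apply: eq_bigl => -[[x z]|[x z]]; rewrite !inE.
  rewrite (inj_eq (@inl_inj _ _)) xpair_eqE (sideP x) black_side side_eq jy.
  rewrite (inj_eq double_inj) val_eqE (eq_sym y) /=; case: eqP => [->|]; rewrite ?andbF //.
  by do 2!case: odd.
by rewrite jy; apply/negbTE/eqP; lia.
Qed.

Lemma big_added_odd (V : Type) (idx : V) (op : Monoid.com_law idx) j y b (F : edge r -> V) :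
  j = y.*2.+1 :> nat ->
  \big[op/idx]_(e in added j) F e = op (F (inr (side b, y))) (F (inr (side (~~ b), y))).
Proof.
move=> jy; transitivity (\big[op/idx]_(e in [set inr (side b, y); inr (side (~~ b), y)]) F e).
  apply: eq_bigl => -[[x z]|[x z]]; rewrite !inE.
    by rewrite jy; apply/negbTE/nandP; right; apply/eqP => /=; lia.
  rewrite !(inj_eq (@inr_inj _ _)) !xpair_eqE (sideP x) !side_eq jy eqSS.
  by rewrite (inj_eq double_inj) val_eqE (eq_sym y); case: b; case: odd; rewrite ?orbF.
by rewrite big_setU1 ?big_set1 // !inE (inj_eq (@inr_inj _ _)) xpair_eqE side_eq; case: b.
Qed.

Lemma big_removed_even (V : Type) (idx : V) (op : Monoid.com_law idx) j y (F : edge r -> V) :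
  j = y.*2 :> nat -> \big[op/idx]_(e in removed j) F e = F (inl (side (~~ odd y), y)).
Proof.
move=> jy; rewrite -[RHS](big_set1 op).
apply: eq_bigl => -[[x z]|[x z]]; rewrite !inE //.
rewrite (inj_eq (@inl_inj _ _)) xpair_eqE (sideP x) black_side side_eq /touches jy /=.
have -> : [|| y.*2 == z.*2, y.*2 == z.*2.+1 | y.*2.+1 == z.*2] = (z == y).
  by rewrite -val_eqE /=; lia.
by case: eqP => [->|]; rewrite ?andbF //; do 2!case: odd.
Qed.

Lemma big_removed_odd (V : Type) (idx : V) (op : Monoid.com_law idx) j y (F : edge r -> V) :
  j = y.*2.+1 :> nat -> \big[op/idx]_(e in removed j) F e =
  op (F (inl (side (~~ odd y), y))) (F (inl (side (odd y), ordS y))).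
Proof.
(* The bound keeps [ordS y] from wrapping around to row 0. *)
move=> jy; have ltyr : (y < r)%N by have := ltn_ord j; lia.
have valS : ordS y = y.+1 :> nat by rewrite /= modn_small.
transitivity (\big[op/idx]_(e in [set inl (side (~~ odd y), y); inl (side (odd y), ordS y)]) F e).
  apply: eq_bigl => -[[x z]|[x z]]; rewrite !inE //.
  rewrite !(inj_eq (@inl_inj _ _)) !xpair_eqE (sideP x) black_side !side_eq /touches jy.
  have -> : [|| y.*2.+1 == z.*2, y.*2.+1 == z.*2.+1 | y.*2.+2 == z.*2] =
      (z == y) || (z == ordS y) by rewrite -!val_eqE [val (ordS y)]valS /=; lia.
  case: eqP => [->|_]; case: eqP => [yS|_]; rewrite ?andbF ?orbF ?andbT //=.
  - by have := congr1 val yS; rewrite [RHS]valS /=; lia.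
  - by do 2!case: odd.
  - by rewrite yS valS /=; do 2!case: odd.
by rewrite big_setU1 ?big_set1 // !inE (inj_eq (@inl_inj _ _)) xpair_eqE side_eq; case: odd.
Qed.

(** * Homology classes of the loops *)

Notation chain := {ffun edge r -> int}.
Implicit Types c d : chain.

Lemma homologous_trans c2 c1 c3 : homologous c1 c2 -> homologous c2 c3 -> homologous c1 c3.
Proof.
move=> [F EF] [G EG]; exists (fun f => F f + G f).
under eq_bigr do rewrite mulrzDr.
by rewrite big_split /= -EF -EG addrA subrK.
Qed.

Lemma homologous_refl c : homologous c c.
Proof. by exists (fun=> 0); rewrite subrr big1. Qed.

Lemma homologous_add c1 d1 c2 d2 :
  homologous c1 d1 -> homologous c2 d2 -> homologous (c1 + c2) (d1 + d2).
Proof.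
move=> [F EF] [G EG]; exists (fun f => F f + G f).
under eq_bigr do rewrite mulrzDr.
by rewrite big_split /= -EF -EG opprD addrACA.
Qed.

Lemma homologous_square f c d : c - d = square_boundary f -> homologous c d.
Proof.
move=> cd; exists (fun g => (g == f)%:Z).
by rewrite (bigD1 f) //= eqxx mulr1z big1 ?addr0 // => g /negbTE->; rewrite mulr0z.
Qed.

Lemma homologous_sum (I : finType) (P : {set I}) (F : I -> chain) d :
  (forall i, i \in P -> homologous (F i) d) -> homologous (\sum_(i in P) F i) (d *+ #|P|).
Proof.
move=> Fd; rewrite -sumr_const; elim/big_ind2: _ => //; first exact: homologous_refl.
by move=> c1 d1 c2 d2; apply: homologous_add.
Qed.

Definition row_loop y : chain := - \sum_(x : 'I_2) edge_chain (inl (x, y)).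

Lemma homologous_row y : homologous (row_loop y) (eta r).
Proof.
suff H n : forall z : 'I_r.+1, z = n :> nat -> homologous (row_loop z) (eta r) by exact: (H y).
elim: n => [|n IH] z zn.
  have -> : z = ord0 by apply: val_inj.
  exact: homologous_refl.
have pz : ord_pred z = n :> nat by rewrite ord_pred_gt0 zn.
apply: homologous_trans (IH _ pz).
(* The two squares between consecutive rows are crossed one at a time; their vertical sides
   cancel. *)
apply: (@homologous_trans (row_loop z - square_boundary (side true, ord_pred z))).
  by apply: (@homologous_square (side true, ord_pred z)); rewrite opprB addrC subrK.
apply: (@homologous_square (side false, ord_pred z)).
rewrite /row_loop !(big_side _ true) /= !ordS_side ord_predK /=.
by apply/ffunP => e; rewrite !ffunE; ring.
Qed.

Lemma homologous_tile j :
  homologous (\sum_(e in added j) black_to_white e - \sum_(e in removed j) black_to_white e)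
    (eta r).
Proof.
have lt_r : (j./2 < r.+1)%N by have := ltn_ord j; lia.
pose y : 'I_r.+1 := Ordinal lt_r.
apply: homologous_trans (homologous_row y); have [j_odd|j_even] := boolP (odd j).
  have jE : j = y.*2.+1 :> nat by rewrite /=; lia.
  have oddS : odd (ordS y) = ~~ odd y.
    by rewrite /= modn_small //; have := ltn_ord j; lia.
  rewrite (big_added_odd _ (~~ odd y) _ jE) (big_removed_odd _ _ jE).
  rewrite /black_to_white /edge_src !black_side oddS !negbK !addNb !addbN !addbb /=.
  (* The loop of an odd tile follows row [y], except that it goes around the other three sides of
     this square instead of its bottom side. *)
  apply: (@homologous_square (side (odd y), y)).
  rewrite /row_loop (big_side _ (odd y)) /= !ordS_side.
  by apply/ffunP => e; rewrite !ffunE; ring.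
have jE : j = y.*2 :> nat by rewrite /=; lia.
(* For an even tile the chain is equal to the row loop itself. *)
rewrite (big_added_even _ _ jE) (big_removed_even _ _ jE).
rewrite /black_to_white /edge_src !black_side !addNb !addbb /=.
rewrite /row_loop (big_side _ (odd y)) /= opprD.
exact: homologous_refl.
Qed.

Lemma homologous_loops_tiling I :
  Gr_independent I -> homologous (loops (tiling I)) (eta r *+ #|I|).
Proof.
move=> indI; rewrite /loops big_added big_removed //= -sumrB.
by apply: homologous_sum => j _; apply: homologous_tile.
Qed.

(* Intersection number with a vertical loop. *)
Definition flux c : int := \sum_y c (inl (side false, y)).

Lemma flux_is_zmod_morphism : zmod_morphism flux.
Proof.
by move=> c d; rewrite /flux -sumrB; apply: eq_bigr => y _; rewrite !ffunE.
Qed.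

HB.instance Definition _ := GRing.isZmodMorphism.Build chain int flux flux_is_zmod_morphism.

Lemma flux_horizontal b y : flux (edge_chain (inl (side b, y))) = (~~ b)%:R.
Proof.
rewrite /flux (bigD1 y) //= big1 => [|z zy]; rewrite ffunE (inj_eq (@inl_inj _ _)) xpair_eqE.
  by rewrite side_eq eqxx addr0; case: b.
by rewrite (negbTE zy) andbF.
Qed.

Lemma flux_vertical v : flux (edge_chain (inr v)) = 0.
Proof. by rewrite /flux big1 // => z _; rewrite ffunE. Qed.

(** The bottom and top sides of a square lie in the same column and have opposite signs in its
    boundary, so every boundary has flux 0. *)
Lemma flux_homologous c d : homologous c d -> flux c = flux d.
Proof.
case=> F cd; apply/eqP; rewrite -subr_eq0 -raddfB cd raddf_sum big1 // => -[x y] _.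
rewrite raddfMz !raddfB raddfD /= (sideP x) !flux_horizontal !flux_vertical.
by rewrite addr0 subr0 subrr mul0rz.
Qed.

Lemma flux_eta : flux (eta r) = -1.
Proof. by rewrite /eta (big_side _ true) raddfN raddfD /= !flux_horizontal. Qed.

(** Since [eta] has flux -1, the flux recovers the multiplicity of [eta]. *)
Lemma homologous_loops_card I k :
  Gr_independent I -> homologous (loops (tiling I)) (eta r *+ k) <-> #|I| = k.
Proof.
move=> indI; split=> [homk|<-]; last exact: homologous_loops_tiling.
have := flux_homologous (homologous_loops_tiling indI).
by rewrite (flux_homologous homk) !raddfMn /= flux_eta; lia.
Qed.

(** * Weights of tiles and of matchings *)

Section Weight.
Variables (R : realType) (A : nat -> R[i]).
Hypothesis A_neq0 : forall i : nat, (1 <= i <= 2 * r)%N -> A i != 0.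

Lemma q_neq0 a : q_ r A a != 0.
Proof. by rewrite /q_; case: ifP => [ar|_]; rewrite ?oner_eq0 // A_neq0; lia. Qed.

Lemma p_neq0 a : p_ r A a != 0.
Proof. by rewrite /p_; case: ifP => [ar|_]; rewrite ?oner_eq0 // A_neq0; lia. Qed.

(** Above row [r] lies the annulus of weight 1, in accordance with the default values of [q_] and
    [p_] at [r+1]. *)
Lemma face_weight_above b y : face_weight A (face_label (side b, y)) =
  if b (+) odd y then p_ r A y.+1 else q_ r A y.+1.
Proof.
rewrite /face_label /p_ /q_ val_side ltnS leq0n /=.
case: eqP => [->|yr]; first by rewrite ltnn; case: ifP.
have -> : (y < r)%N by have := ltn_ord y; lia.
by case: b; case: (odd y); rewrite /face_weight ?addnS.
Qed.

(** The columns of the [q] and [p] faces alternate with height, so the two cases are swapped. Below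
    row 0 the torus wraps to the annulus, matching the default values at 0. *)
Lemma face_weight_below b y : face_weight A (face_label (side b, ord_pred y)) =
  if b (+) odd y then q_ r A y else p_ r A y.
Proof.
rewrite face_weight_above; case: (posnP y) => y0.
  by rewrite ord_pred0 // y0 /p_ /q_ ltnn andbF; case: ifP; case: ifP.
rewrite ord_pred_gt0 // prednK //; have -> : odd y = ~~ odd y.-1 by lia.
by rewrite addbN; case: (b (+) _).
Qed.

Lemma edge_weight_horizontal b y : edge_weight A (inl (side b, y)) =
  if b (+) odd y then (p_ r A y.+1 * q_ r A y)^-1 else (q_ r A y.+1 * p_ r A y)^-1.
Proof.
rewrite /edge_weight [side_faces _]/= face_weight_above face_weight_below.
by case: ifP.
Qed.

Lemma edge_weight_vertical b y :
  edge_weight A (inr (side b, y)) = (q_ r A y.+1 * p_ r A y.+1)^-1.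
Proof.
rewrite /edge_weight [side_faces _]/= ord_pred_side !face_weight_above.
by case: b; case: odd => //=; rewrite mulrC.
Qed.

Lemma edge_weight_neq0 (e : edge r) : edge_weight A e != 0.
Proof.
case: e => -[x y]; rewrite (sideP x) ?edge_weight_horizontal ?edge_weight_vertical.
  by case: ifP => _; rewrite invr_neq0 // mulf_neq0 ?p_neq0 ?q_neq0.
by rewrite invr_neq0 // mulf_neq0 ?p_neq0 ?q_neq0.
Qed.

(** A tile [2y] or [2y+1] corresponds to the index [a = y+1] in [gamma]; in the odd case one factor
    [q_a p_a] of the two vertical edges cancels against the removed edges. *)
Lemma tile_weight j :
  (\prod_(e in added j) edge_weight A e) / (\prod_(e in removed j) edge_weight A e) =
  gamma r A j.+1.
Proof.
have lt_r : (j./2 < r.+1)%N by have := ltn_ord j; lia.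
pose y : 'I_r.+1 := Ordinal lt_r.
have [j_odd|j_even] := boolP (odd j).
  have jE : j = y.*2.+1 :> nat by rewrite /=; lia.
  have valS : ordS y = y.+1 :> nat.
    by rewrite /= modn_small //; have := ltn_ord j; lia.
  rewrite (big_added_odd _ (odd y) _ jE) (big_removed_odd _ _ jE) /=.
  rewrite !edge_weight_vertical !edge_weight_horizontal valS.
  rewrite !addNb !addbN !addbb /gamma jE /= odd_double uphalf_double /=.
  by field; rewrite !p_neq0 !q_neq0.
have jE : j = y.*2 :> nat by rewrite /=; lia.
rewrite (big_added_even _ _ jE) (big_removed_even _ _ jE) !edge_weight_horizontal.
rewrite !addNb !addbb /gamma jE /= odd_double doubleK /=.
by field; rewrite !p_neq0 !q_neq0.
Qed.

Lemma tiling_weight I : Gr_independent I ->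
  matching_weight A (tiling I) / matching_weight A (M0 r) = \prod_(j in I) gamma r A j.+1.
Proof.
move=> indI; rewrite /matching_weight (big_setID (M0 r)) [X in _ / X](big_setID (tiling I)) /=.
(* The edges common to the matching and [M0] cancel, their weights being nonzero. *)
rewrite setIC -mulf_div divff ?mul1r; last first.
  by apply/prodf_neq0 => e _; apply: edge_weight_neq0.
rewrite big_added big_removed //= -prodf_div.
by apply: eq_bigr => j _; apply: tile_weight.
Qed.

End Weight.
End Torus.

Theorem theorem5p5 (R : realType) (r : nat) (hr : (1 <= r)%N)
    (A : nat -> R[i]) (hA : forall i : nat, (1 <= i <= 2 * r)%N -> A i != 0)
    (k : nat) (hk : (1 <= k <= r)%N) :
  Hk r A k =
  \sum_(I : {set 'I_(2 * r).+1} | (#|I| == k) && Gr_independent I)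
    \prod_(i in I) gamma r A i.+1.
Proof.
(* Every perfect matching is the tiling of its tiles, so the sum may run over sets of tiles;
   [tilingK] then discharges the side condition of the reindexing. *)
rewrite /Hk (reindex_onto (@tiling r) (@tiles r)) => [|M /andP[pM _]]; last exact: tilesK.
apply: eq_big => [I|I /andP[/andP[pI _] _]].
  rewrite tilingK // eqxx andbT perfect_tiling // -independentE // andbC.
  case indI: (Gr_independent I); rewrite ?andbF // !andbT.
  have := homologous_loops_card hr k indI => homk.
  by apply/asboolP/eqP => /homk.
by apply: tiling_weight => //; rewrite independentE // -perfect_tiling.
Qed.
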